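(* Let $\mathcal{F}$ be the one-parameter family $y^2 = x^3 + x + T^3$. For every odd prime $p$ with $p \equiv 2 \pmod 3$, the second moment of $\mathcal{F}$ at $p$ satisfies $$\mathcal{A}_{2,\mathcal{F}}(p) \;=\; \sum_{t=0}^{p-1} a_t(p)^2 \;=\; p^2 + p,$$ where $a_t(p) = -\sum_{x=0}^{p-1} \left(\frac{x^3 + x + t^3}{p}\right)$.
   Context: For an odd prime $p$, $\left(\frac{a}{p}\right)$ is the Legendre symbol: $1$ if $a$ is a non-zero square modulo $p$, $0$ if $a \equiv 0 \pmod p$, and $-1$ otherwise. For a family $\mathcal{E}: y^2 = x^3 + A(T)x + B(T)$ with specializations $E_t: y^2 = x^3 + A(t)x + B(t)$ for integers $t$, set $a_t(p) := p + 1 - \#E_t(\mathbb{F}_p)$, where $\#E_t(\mathbb{F}_p)$ is the number of solutions of the equation modulo $p$ including the point at infinity (the equation modulo $p$ is allowed to be singular); equivalently $a_t(p) = -\sum_{x=0}^{p-1}\left(\frac{x^3 + A(t)x + B(t)}{p}\right)$. The $m$-th moment (not normalized by $1/p$) is $\mathcal{A}_{m,\mathcal{E}}(p) := \sum_{t=0}^{p-1} a_t(p)^m$. Here $A(T) = 1$ and $B(T) = T^3$. *)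

(* Defs.v *)
From HB Require Import structures.
From mathcomp Require Import all_boot all_order all_algebra.
Set Implicit Arguments.
Unset Strict Implicit.
Unset Printing Implicit Defensive.
Import Order.TTheory GRing.Theory Num.Theory.
Local Open Scope ring_scope.

(* 'F_p is the field with p elements only for p prime; all the definitions
   below are meant for an odd prime p. *)

Definition legendre (p : nat) (a : int) : int :=
  if a%:~R == 0 :> 'F_p then 0
  else if [exists b : 'F_p, b ^+ 2 == a%:~R] then 1
  else -1.

(* A family y^2 = x^3 + A(T) x + B(T) is given by A, B in Z[T]. *)

Definition affine_points (A B : {poly int}) (p : nat) (t : int)
  : {set 'F_p * 'F_p} :=
  [set P : 'F_p * 'F_p |
    P.2 ^+ 2 == P.1 ^+ 3 + A.[t]%:~R * P.1 + B.[t]%:~R].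

(* The point at infinity accounts for the successor. *)
Definition num_points (A B : {poly int}) (p : nat) (t : int) : nat :=
  #|affine_points A B p t|.+1.

Definition trace_at (A B : {poly int}) (p : nat) (t : int) : int :=
  p%:Z + 1 - (num_points A B p t)%:Z.

(* Not normalized by 1/p. *)
Definition moment (m : nat) (A B : {poly int}) (p : nat) : int :=
  \sum_(0 <= t < p) trace_at A B p t%:Z ^+ m.

Definition famA : {poly int} := 1.
Definition famB : {poly int} := 'X^3.

(* Main.v *)
Require Import Defs.
From HB Require Import structures.
From mathcomp Require Import all_boot all_order all_algebra all_field.
From mathcomp Require Import ring zify.
Set Implicit Arguments.
Unset Strict Implicit.
Unset Printing Implicit Defensive.
Import Order.TTheory GRing.Theory Num.Theory.
Local Open Scope ring_scope.

(** Since p = 2 mod 3, cubing permutes F_p, so t^3 may be replaced by a free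
    parameter b.  With N_b the number of affine points of y^2 = x^3 + x + b,
    the sum of the N_b is p^2, and the sum of the N_b^2 counts the solutions of
    y^2 - y'^2 = f(x) - f(x') where f(x) = x^3 + x.  For fixed (x, x') this is a
    hyperbola, with p - 1 points, or p more when f(x) = f(x').  Finally
    f(x) = f(x') splits into the line x = x' and the conic
    x^2 + x x' + x'^2 = -1.  As -3 is not a square, the two are disjoint and the
    conic has p + 1 points: for a non-square d and c <> 0, the conic
    x^2 - d y^2 = c and the hyperbola x^2 - y^2 = c have 2p points together. *)

(** * Sums of Boolean indicators *)

Lemma sum_pred1 (T : finType) (a : T) : (\sum_(x : T) (x == a) = 1)%N.
Proof. by rewrite (bigD1 a) //= eqxx big1 // => x /negPf->. Qed.

Lemma sum_diag (T : finType) (a b : T) :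
  (\sum_(x : T) (a == x) * (b == x) = (a == b))%N.
Proof.
rewrite (bigD1 a) //= eqxx mul1n big1 ?addn0 1?eq_sym // => x /negPf ax.
by rewrite eq_sym ax.
Qed.

Lemma sum_fibers (T U : finType) (h : T -> U) :
  (\sum_(u : U) \sum_(t : T) (h t == u) = #|T|)%N.
Proof.
rewrite exchange_big /= -sum1_card; apply: eq_bigr => t _.
by under eq_bigr do rewrite eq_sym; exact: sum_pred1.
Qed.

(** * Counting points over a finite field of odd characteristic *)

Section FiniteField.

Variable K : finFieldType.
Hypothesis two_neq0 : 2%:R != 0 :> K.

Lemma card_sqrt (a : K) :
  (\sum_(y : K) (y ^+ 2 == a) =
     (if (a == 0)%R then 1 else if [exists b : K, b ^+ 2 == a] then 2 else 0))%N.
Proof.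
case: eqP => [->|/eqP a0].
  by under eq_bigr do rewrite sqrf_eq0; exact: sum_pred1.
case: existsP => [[b /eqP ba]|nex]; last first.
  by rewrite big1 // => y _; case: eqP => // ya; case: nex; exists y; apply/eqP.
have bN : b != - b.
  apply: contra a0 => /eqP bN; rewrite -ba sqrf_eq0.
  have : 2%:R * b == 0 by rewrite mulr_natl mulr2n {1}bN addNr.
  by rewrite mulf_eq0 (negPf two_neq0).
rewrite (eq_bigr (fun y : K => (y == b) + (y == - b)%R))%N.
  by rewrite big_split /= !sum_pred1.
by move=> y _; rewrite -ba eqf_sqr; case: eqVneq => // ->; rewrite (negPf bN).
Qed.

Lemma card_sqrt_nonsquare (d : K) : (forall s : K, s ^+ 2 != d) ->
  forall a : K, (\sum_(y : K) (y ^+ 2 == a) + \sum_(y : K) (d * y ^+ 2 == a)%R = 2)%N.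
Proof.
(* Each of these counts is at most 2, and they add up to [2 * #|K|]. *)
move=> dN; have d0 : d != 0 by have := dN 0; rewrite expr0n eq_sym.
pose g (a : K) := (\sum_(y : K) (y ^+ 2 == a) + \sum_(y : K) (d * y ^+ 2 == a)%R)%N.
have dE (a : K) :
    (\sum_(y : K) (d * y ^+ 2 == a)%R = \sum_(y : K) (y ^+ 2 == a / d)%R)%N.
  by apply: eq_bigr => y _; rewrite -(can2_eq (mulfK d0) (mulfVK d0)) mulrC.
have g_le2 a : (g a <= 2)%N.
  rewrite /g dE !card_sqrt mulf_eq0 invr_eq0 (negPf d0) orbF.
  case: ifPn => // a0; case: existsP => [[b /eqP ba]|_]; last by case: ifP.
  (* If [a] and [a / d] were both non-zero squares, their quotient [d] would be a square. *)
  case: existsP => // -[c /eqP ca]; have c0 : c != 0.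
    by rewrite -sqrf_eq0 ca mulf_eq0 invr_eq0 negb_or a0.
  by case/negP: (dN (b / c)); rewrite expr_div_n ca ba invf_div mulrC divfK.
have sum_g : (\sum_(a : K) g a = \sum_(a : K) 2)%N.
  by rewrite big_split /= !sum_fibers sum_nat_const muln2 addnn.
move=> a; apply/eqP; rewrite -[_ == _]/(g a == 2) eqn_leq g_le2 /= leqNgt.
apply/negP => ga; move: sum_g; rewrite (bigD1 a) //= [RHS](bigD1 a) //=.
have := leq_add ga (leq_sum (index_enum K) (P := predC1 a) (fun i _ => g_le2 i)).
by move=> + e; rewrite addSn e ltnn.
Qed.

(** In the coordinates u = x - y, v = x + y the equation becomes u v = c. Each u <> 0 gives one v; u
    = 0 leaves v free if c = 0 and gives nothing otherwise. *)
Lemma card_hyperbola (c : K) :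
  (\sum_(x : K) \sum_(y : K) (x ^+ 2 - y ^+ 2 == c)%R = #|K|.-1 + #|K| * (c == 0)%R)%N.
Proof.
pose h (z : K * K) := ((z.1 + z.2) / 2%:R, (z.2 - z.1) / 2%:R).
pose h' (z : K * K) := (z.1 - z.2, z.1 + z.2).
have hK : cancel h h' by case=> u v; rewrite /h /h' /=; congr pair; field.
have h'K : cancel h' h by case=> u v; rewrite /h /h' /=; congr pair; field.
rewrite pair_big /= (reindex h) /=; last by exists h' => z _; rewrite ?hK ?h'K.
rewrite (eq_bigr (fun z : K * K => (z.1 * z.2 == c) : nat)); last first.
  by move=> [u v] _ /=; congr (nat_of_bool (_ == c)); field.
rewrite -(pair_big xpredT xpredT (fun u v : K => (u * v == c) : nat)) /=.
rewrite (bigD1 0) //= addnC; congr addn.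
  under eq_bigr => u u0.
    under eq_bigr => v _ do rewrite mulrC (can2_eq (mulfK u0) (mulfVK u0)).
    rewrite sum_pred1; over.
  by rewrite sum1_card cardC1.
by under eq_bigr do rewrite mul0r eq_sym; rewrite sum_nat_const.
Qed.

Lemma card_norm_conic (d c : K) : (forall s : K, s ^+ 2 != d) -> c != 0 ->
  (\sum_(x : K) \sum_(y : K) (x ^+ 2 - d * y ^+ 2 == c)%R = #|K|.+1)%N.
Proof.
move=> dN c0.
have: (\sum_(x : K) \sum_(y : K) (x ^+ 2 - y ^+ 2 == c)%R +
       \sum_(x : K) \sum_(y : K) (x ^+ 2 - d * y ^+ 2 == c)%R = 2 * #|K|)%N.
  (* For fixed [x], these count the [y] with [y^2 = x^2 - c] or [d y^2 = x^2 - c]. *)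
  rewrite -big_split /= mulnC -sum_nat_const; apply: eq_bigr => x _.
  rewrite -[RHS](card_sqrt_nonsquare dN (x ^+ 2 - c)); congr addn;
    by apply: eq_bigr => y _; rewrite subr_eq addrC -subr_eq eq_sym.
rewrite card_hyperbola (negPf c0).
have : (0 < #|K|)%N by apply/card_gt0P; exists 0.
lia.
Qed.

(** Given x and y, the only b that fits is y^2 - f x. *)
Lemma sum_points (f : K -> K) :
  (\sum_(b : K) \sum_(x : K) \sum_(y : K) (y ^+ 2 == f x + b)%R = #|K| ^ 2)%N.
Proof.
rewrite exchange_big /= -mulnn -sum_nat_const; apply: eq_bigr => x _.
rewrite -[RHS](sum_fibers (fun y => y ^+ 2 - f x)).
by apply: eq_bigr => b _; apply: eq_bigr => y _; rewrite subr_eq addrC.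
Qed.

Lemma sum_points_sqr (f : K -> K) :
  (\sum_(b : K) (\sum_(x : K) \sum_(y : K) (y ^+ 2 == f x + b)%R) ^ 2 =
   #|K|.-1 * #|K| ^ 2 + #|K| * \sum_(x : K) \sum_(y : K) (f x == f y))%N.
Proof.
transitivity (\sum_(x : K) \sum_(x' : K) \sum_(y : K) \sum_(y' : K)
    (y ^+ 2 - y' ^+ 2 == f x - f x')%R)%N.
  under eq_bigr => b _.
    rewrite -mulnn big_distrl /=.
    under eq_bigr => x _.
      rewrite big_distrr /=.
      under eq_bigr => x' _.
        rewrite big_distrl /=.
        under eq_bigr => y _ do rewrite big_distrr /=.
        over.
      over.
    over.
  rewrite exchange_big; apply: eq_bigr => x _.
  rewrite exchange_big; apply: eq_bigr => x' _.
  rewrite exchange_big; apply: eq_bigr => y _.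
  rewrite exchange_big; apply: eq_bigr => y' _ /=.
  (* The four coordinates prescribe [b] twice, as y^2 - f x and as y'^2 - f x', so one [b] exists if
     these agree and none otherwise. *)
  under eq_bigr => b _ do rewrite ![_ + b]addrC -!subr_eq.
  rewrite sum_diag; congr nat_of_bool.
  by rewrite -subr_eq0 -[RHS]subr_eq0; congr (_ == 0); ring.
under eq_bigr => x _ do under eq_bigr => x' _ do
  rewrite card_hyperbola subr_eq0.
under eq_bigr => x _ do rewrite big_split /= sum_nat_const -big_distrr /=.
by rewrite big_split /= sum_nat_const -big_distrr /= mulnA mulnn mulnC.
Qed.

Hypothesis three_neq0 : 3%:R != 0 :> K.
Hypothesis cube_inj : injective (fun x : K => x ^+ 3).

Lemma opp3_nonsquare (s : K) : s ^+ 2 != - 3%:R.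
Proof.
apply/eqP => s2.
(* Otherwise [(s - 1) / 2] is a primitive cube root of unity. *)
have : (s - 1) / 2%:R = 1.
  apply: cube_inj; rewrite expr1n.
  have -> : ((s - 1) / 2%:R) ^+ 3 =
      1 + (s ^+ 2 - - 3%:R) * (s - 3%:R) / 8%:R.
    by field; rewrite -[8%N]/(2 ^ 3)%N natrX expf_neq0.
  by rewrite s2 subrr !mul0r addr0.
(* Now s = 3, so s^2 = -3 reads 12 = 0, impossible when 2 and 3 are non-zero. *)
move/(canRL (divfK two_neq0)); rewrite mul1r => /(canRL (subrK 1)) s3.
have : 2%:R * 2%:R * 3%:R == 0 :> K.
  by apply/eqP; transitivity (s ^+ 2 - - 3%:R); [rewrite s3; ring | rewrite s2 subrr].
by rewrite !mulf_eq0 (negPf two_neq0) (negPf three_neq0).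
Qed.

Lemma card_cubic_collisions :
  (\sum_(x : K) \sum_(y : K) (x ^+ 3 + x == y ^+ 3 + y)%R = #|K| + #|K|.+1)%N.
Proof.
(* Multiplying the conic by 4 completes the square: (2 x + y)^2 + 3 y^2 = -4, a norm conic with d =
   -3. *)
have E (x y : K) : ((x ^+ 3 + x == y ^+ 3 + y) : nat) =
   ((y == x) + ((2%:R * x + y) ^+ 2 - - 3%:R * y ^+ 2 == - 4%:R)%R)%N.
  have four0 : 4%:R != 0 :> K by rewrite -[4%N]/(2 ^ 2)%N natrX expf_neq0.
  have -> : ((2%:R * x + y) ^+ 2 - - 3%:R * y ^+ 2 == - 4%:R) =
       (x ^+ 2 + x * y + y ^+ 2 + 1 == 0).
    rewrite -subr_eq0.
    have -> : (2%:R * x + y) ^+ 2 - - 3%:R * y ^+ 2 - - 4%:R =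
      4%:R * (x ^+ 2 + x * y + y ^+ 2 + 1) by ring.
    by rewrite mulf_eq0 (negPf four0).
  rewrite -subr_eq0.
  have -> : x ^+ 3 + x - (y ^+ 3 + y) = (x - y) * (x ^+ 2 + x * y + y ^+ 2 + 1) by ring.
  rewrite mulf_eq0 subr_eq0 (eq_sym y x); case: eqP => [->|//] /=.
  (* A point of the conic with x = y has 3 y^2 = -1, hence (3 y)^2 = -3. *)
  case: eqP => // conic; case/eqP: (opp3_nonsquare (3%:R * y)).
  apply/eqP; rewrite -subr_eq0; apply/eqP.
  transitivity (3%:R * (y ^+ 2 + y * y + y ^+ 2 + 1)); first by ring.
  by rewrite conic mulr0.
under eq_bigr => x _ do under eq_bigr => y _ do rewrite E.
under eq_bigr => x _ do rewrite big_split /= sum_pred1.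
rewrite big_split /= sum1_card; congr addn.
rewrite -(@card_norm_conic (- 3%:R) (- 4%:R) opp3_nonsquare); last first.
  by rewrite oppr_eq0 -[4%N]/(2 ^ 2)%N natrX expf_neq0.
(* Once y is fixed, 2 x + y runs over [K] with x; hence y is made the outer variable. *)
rewrite exchange_big [RHS]exchange_big /=; apply: eq_bigr => y _.
rewrite [RHS](reindex (fun x => 2%:R * x + y)) //.
by exists (fun x => (x - y) / 2%:R) => x _; field.
Qed.

End FiniteField.

Lemma cube_inj_card (K : finFieldType) :
  (#|K| = 2 %[mod 3])%N -> injective (fun x : K => x ^+ 3).
Proof.
move=> K3; pose k := (#|K| %/ 3)%N.
have KE : #|K| = (k * 3 + 2)%N by rewrite {1}(divn_eq #|K| 3) K3.
(* [2 * #|K| - 1 = 3 * (2 * k + 1)], so the (2 k + 1)-st power inverts cubing *)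
have inv_cube (x : K) : (x ^+ 3) ^+ (2 * k).+1 = x.
  rewrite -exprM; have [->|x0] := eqVneq x 0; first by rewrite expr0n.
  (* The extra factor x brings the exponent to twice the order q of [K], where x^q = x applies to
     both halves. *)
  apply: (mulIf x0); rewrite -exprSr.
  have -> : ((3 * (2 * k).+1).+1 = #|K| + #|K|)%N by lia.
  by rewrite exprD expf_card.
exact: (can_inj (g := fun x => x ^+ (2 * k).+1)).
Qed.

(** * Transfer to the prime field *)

Lemma natr_Fp_neq0 (p n : nat) : prime p -> ~~ (p %| n)%N -> n%:R != 0 :> 'F_p.
Proof. by move=> pp; rewrite -(dvdn_pcharf (pchar_Fp pp)). Qed.

Lemma two_Fp_neq0 (p : nat) : prime p -> odd p -> 2%:R != 0 :> 'F_p.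
Proof.
move=> pp p_odd; apply: natr_Fp_neq0 => //.
by rewrite dvdn_prime2 //; apply: contraL p_odd => /eqP->.
Qed.

Lemma big_Fp (R : Type) (idx : R) (op : Monoid.com_law idx) (p : nat)
    (F : 'F_p -> R) : prime p ->
  \big[op/idx]_(0 <= x < p) F (x%:Z%:~R) = \big[op/idx]_(x : 'F_p) F x.
Proof.
(* The carrier of ['F_p] is an ordinal type whose bound equals p only by primality. *)
move=> pp; rewrite -[X in \big[_/_]_(0 <= _ < X) _](Fp_cast pp) big_mkord.
by apply: eq_bigr => x _; rewrite -[_%:~R]/(x%:R) natr_Zp.
Qed.

Lemma Posz_sum (T : finType) (F : T -> nat) :
  (\sum_(x : T) F x)%N%:Z = \sum_(x : T) (F x)%:Z.
Proof. exact: (big_morph Posz PoszD (erefl 0%:Z)). Qed.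

Lemma trace_at_fam (p : nat) (t : int) :
  trace_at famA famB p t = p%:Z -
    (\sum_(x : 'F_p) \sum_(y : 'F_p) (y ^+ 2 == x ^+ 3 + x + t%:~R ^+ 3)%R)%:Z.
Proof.
rewrite /trace_at /num_points /affine_points -sum1_card pair_big /=.
have -> : (\sum_(P in [set P : 'F_p * 'F_p | (P.2 ^+ 2 ==
    P.1 ^+ 3 + famA.[t]%:~R * P.1 + famB.[t]%:~R)%R]) 1 =
   \sum_(P : 'F_p * 'F_p) (P.2 ^+ 2 == P.1 ^+ 3 + P.1 + t%:~R ^+ 3)%R)%N.
  rewrite big_mkcond; apply: eq_bigr => P _.
  by rewrite inE /famA /famB hornerXn hornerC mul1r rmorphXn /=; case: ifP.
(* The point at infinity cancels the 1 of p + 1. *)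
by rewrite -add1n PoszD addrKA.
Qed.

(** An element has 1 plus its Legendre symbol square roots; summed over x, the ones account for
    p. *)
Lemma trace_at_legendre (p : nat) (t : int) : prime p -> odd p ->
  trace_at famA famB p t =
    - \sum_(0 <= x < p) legendre p (x%:Z ^+ 3 + x%:Z + t ^+ 3).
Proof.
move=> pp p_odd.
have two0 := two_Fp_neq0 pp p_odd.
rewrite trace_at_fam.
pose l (a : 'F_p) : int :=
  if a == 0 then 0 else if [exists b : 'F_p, b ^+ 2 == a] then 1 else -1.
have -> : \sum_(0 <= x < p) legendre p (x%:Z ^+ 3 + x%:Z + t ^+ 3) =
    \sum_(x : 'F_p) l (x ^+ 3 + x + t%:~R ^+ 3).
  rewrite -(big_Fp _ (fun x => l (x ^+ 3 + x + t%:~R ^+ 3)) pp).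
  by apply: eq_bigr => x _; rewrite /legendre !rmorphD !rmorphXn.
have -> : p%:Z = \sum_(x : 'F_p) 1 by rewrite sumr_const card_Fp // natz.
rewrite Posz_sum -sumrB -sumrN; apply: eq_bigr => x _.
by rewrite card_sqrt // /l; case: ifP => // _; case: ifP.
Qed.

Theorem lemma3p1 (p : nat) (p_prime : prime p) (p_odd : odd p)
    (p_mod3 : (p = 2 %[mod 3])%N) :
  (forall t : int,
     trace_at famA famB p t =
       - \sum_(0 <= x < p) legendre p (x%:Z ^+ 3 + x%:Z + t ^+ 3)) /\
  moment 2 famA famB p = p%:Z ^+ 2 + p%:Z.
Proof.
split=> [t|]; first exact: trace_at_legendre.
have two0 := two_Fp_neq0 p_prime p_odd.
have three0 : 3%:R != 0 :> 'F_p.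
  apply: natr_Fp_neq0 => //; rewrite dvdn_prime2 //; apply/eqP => p3.
  by move: p_mod3; rewrite p3.
have cK : #|'F_p| = p by exact: card_Fp.
have cube : injective (fun x : 'F_p => x ^+ 3) by apply: cube_inj_card; rewrite cK.
pose N (b : 'F_p) := (\sum_(x : 'F_p) \sum_(y : 'F_p) (y ^+ 2 == x ^+ 3 + x + b)%R)%N.
have -> : moment 2 famA famB p = \sum_(b : 'F_p) (p%:Z - (N b)%:Z) ^+ 2.
  rewrite [RHS](reindex_inj cube) /=.
  rewrite -(big_Fp _ (fun t => (p%:Z - (N (t ^+ 3))%:Z) ^+ 2) p_prime).
  by apply: eq_bigr => t _; rewrite trace_at_fam.
have S1 := sum_points (fun x : 'F_p => x ^+ 3 + x).
have S2 := sum_points_sqr two0 (fun x : 'F_p => x ^+ 3 + x).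
rewrite card_cubic_collisions // cK -/(N _) in S2.
rewrite cK in S1.
under eq_bigr => b _ do rewrite sqrrB.
rewrite big_split sumrB /= sumr_const cK.
have -> : \sum_(b : 'F_p) (N b)%:Z ^+ 2 = (p.-1 * p ^ 2 + p * (p + p.+1))%N%:Z.
  by rewrite -S2 Posz_sum; apply: eq_bigr => b _; rewrite -!natz natrX.
have -> : \sum_(b : 'F_p) p%:Z * (N b)%:Z *+ 2 = p%:Z * (p ^ 2)%N%:Z *+ 2.
  by rewrite sumrMnl -mulr_sumr -S1 Posz_sum.
(* As p > 0, p is [p.-1.+1], which disposes of the truncated predecessor. *)
have -> : (p.-1 * p ^ 2 + p * (p + p.+1))%N%:Z = p%:Z ^+ 3 + p%:Z ^+ 2 + p%:Z.
  by rewrite -{1 2 3 4 5}(prednK (prime_gt0 p_prime)) /=; lia.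
have -> : (p ^ 2)%N%:Z = p%:Z ^+ 2 by rewrite -!natz natrX.
(* What remains is p^3 - 2 p^3 + (p^3 + p^2 + p) = p^2 + p. *)
by rewrite -mulr_natr natz; ring.
Qed.
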